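(* Let $F$ be a real field, let $n \ge 1$, and let $A$ be a symmetric $n \times n$ matrix with entries in $F$. If every principal minor of $A$ can be expressed as a sum of squares of elements of $F$, then $A$ is a sum of squares of symmetric matrices with entries in $F$; that is, there exist finitely many symmetric $n \times n$ matrices $B_1,\ldots,B_k$ with entries in $F$ such that $A = B_1^2 + \cdots + B_k^2$.
   Context: A field $F$ is real if $-1$ is not a sum of squares in $F$. A principal minor of a square matrix is the determinant of a submatrix determined by the same set of row and column indices (the index set may be any nonempty subset of the indices). *)

(* Defs.v *)
From HB Require Import structures.
From mathcomp Require Import all_boot all_order all_algebra.

Set Implicit Arguments.
Unset Strict Implicit.
Unset Printing Implicit Defensive.

Import GRing.Theory.
Local Open Scope ring_scope.

Definition sum_of_squares (R : pzRingType) (a : R) : Prop :=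
  exists (k : nat) (x : 'I_k -> R), a = \sum_(i < k) x i ^+ 2.

(* "Real" in the sense of Artin-Schreier: no order on F is given. *)
Definition real_field (F : fieldType) : Prop := ~ sum_of_squares (-1 : F).

(* On {set 'I_n}, enum_val lists the elements of S in increasing order. *)
Definition principal_submx (R : Type) (n : nat) (A : 'M[R]_n) (S : {set 'I_n}) :
    'M[R]_#|S| :=
  mxsub (@enum_val _ (mem S)) (@enum_val _ (mem S)) A.

Definition principal_minor (R : comPzRingType) (n : nat) (A : 'M[R]_n)
    (S : {set 'I_n}) : R :=
  \det (principal_submx A S).

(* Main.v *)
Require Import Defs.
From mathcomp Require Import all_boot all_order all_algebra.

(* Expanding det (t I + A) shows that its coefficients are sums of principal
   minors, hence sums of squares.  Cayley-Hamilton for -A, split by parity of the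
   exponents and multiplied by A when n is even, reads A U = T where U and T are
   combinations of even powers of A with sum-of-squares coefficients, the term of
   highest degree of U having coefficient 1.  Over a real field a form
   v |-> v U v^T can only vanish on ker A.  Let P be the orthogonal projection
   onto ker A: then Q = U + P is invertible, A Q = T, and A = (T Q) (Q^-1)^2.
   All squares involved are squares of commuting symmetric matrices, so this
   product is again a sum of squares of symmetric matrices. *)

Set Implicit Arguments.
Unset Strict Implicit.
Unset Printing Implicit Defensive.

Import GRing.Theory.
Local Open Scope ring_scope.

(** * The characteristic polynomial in terms of principal minors *)

(** Sylvester's identity: both sides are the determinant of a product of the same two block
    matrices, taken in the two possible orders. *)
Lemma det1D_mulC (R : comPzRingType) (m n : nat) (U : 'M[R]_(m, n))
    (V : 'M[R]_(n, m)) :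
  \det (1%:M + U *m V) = \det (1%:M + V *m U).
Proof.
have E1 : block_mx 1%:M (- U) V 1%:M *m block_mx 1%:M U 0 1%:M =
    block_mx 1%:M 0 V (1%:M + V *m U).
  by rewrite mulmx_block !(mulmx1, mul1mx, mulmx0, addr0, mulNmx) subrr addrC.
have E2 : block_mx 1%:M U 0 1%:M *m block_mx 1%:M (- U) V 1%:M =
    block_mx (1%:M + U *m V) 0 V 1%:M.
  by rewrite mulmx_block !(mulmx1, mul1mx, mul0mx, add0r) addNr.
have := congr1 determinant E1; rewrite det_mulmx mulrC -det_mulmx E2.
by rewrite !det_lblock !det1 mul1r mulr1.
Qed.

(** With [E] the rows of the identity indexed by [S], [E *m E^T] is the identity and the submatrix
    is [1 + (E A - E) E^T]. Then [det1D_mulC] passes to an [n]-by-[n] determinant. *)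
Lemma det_rows_outside1 (R : comPzRingType) (n : nat) (A : 'M[R]_n)
    (S : {set 'I_n}) :
  \det (\matrix_(i, j) (if i \in S then A i j else (i == j)%:R)) =
  principal_minor A S.
Proof.
pose f := @enum_val _ (mem S); pose E := rowsub f (1%:M : 'M[R]_n).
have EtM (B : 'M[R]_n) i j :
    (E^T *m rowsub f B) i j = if i \in S then B i j else 0.
  rewrite mxE.
  under eq_bigr => k _ do rewrite !mxE.
  rewrite -(big_enum_val (fun l => (l == i)%:R * B l j)) /=.
  case: ifP => Si.
    rewrite (bigD1 i) //= eqxx mul1r big1 ?addr0 // => l /andP[_ /negPf ->].
    by rewrite mul0r.
  rewrite big1 // => l Sl; case: eqP => [eli|_]; last by rewrite mul0r.
  by rewrite -eli Sl in Si.
have EEt : E *m E^T = 1%:M.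
  apply/matrixP => i j; rewrite !mxE.
  under eq_bigr => k _ do rewrite !mxE.
  rewrite (bigD1 (f i)) //= eqxx mul1r big1 ?addr0.
    by rewrite (inj_eq enum_val_inj) eq_sym.
  by move=> l /negPf; rewrite eq_sym => ->; rewrite mul0r.
have subE : principal_submx A S = E *m A *m E^T.
  rewrite /principal_submx -[A in LHS]mulmx1 mxsub_mul rowsubE -/E.
  congr (_ *m _).
  by apply/matrixP => i j; rewrite !mxE eq_sym.
rewrite /principal_minor subE.
have -> : E *m A *m E^T = 1%:M + (E *m A - E) *m E^T.
  by rewrite mulmxBl EEt addrC subrK.
rewrite -det1D_mulC; congr (\det _); apply/matrixP => i j.
rewrite /E -rowsubE -[rowsub f A - _](_ : rowsub f (A - 1%:M) = _); last first.
  by apply/matrixP => k l; rewrite !mxE.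
rewrite mxE [RHS]mxE EtM !mxE; case: ifP => _; last by rewrite addr0.
by rewrite addrC subrK.
Qed.

(** Multilinearity in the rows: [S] collects the rows taken from [A], and each other row contributes
    a factor [a]. *)
Lemma det_scalarD (R : comPzRingType) (n : nat) (A : 'M[R]_n) (a : R) :
  \det (a%:M + A) = \sum_(S : {set 'I_n}) principal_minor A S * a ^+ #|~: S|.
Proof.
pose M (S : {set 'I_n}) :=
  \matrix_(i, j) (if i \in S then A i j else a *+ (i == j)).
transitivity (\sum_S \det (M S)).
  rewrite /determinant exchange_big; apply: eq_bigr => /= s _.
  rewrite -mulr_sumr; congr (_ * _).
  under eq_bigr => i _ do rewrite !mxE addrC.
  rewrite bigA_distr /=; apply: eq_bigr => S _.
  by apply: eq_bigr => i _; rewrite mxE.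
apply: eq_bigr => S _.
pose d := \row_(i < n) (if i \in S then 1 else a).
have -> : M S = diag_mx d *m
    \matrix_(i, j) (if i \in S then A i j else (i == j)%:R).
  apply/matrixP => i j; rewrite mul_diag_mx !mxE.
  by case: ifP; rewrite ?mul1r ?mulr_natr.
rewrite det_mulmx det_rows_outside1 det_diag mulrC; congr (_ * _).
rewrite -prodr_const (bigID (fun i => i \in S)) /= big1 ?mul1r => [|i Si].
  apply: eq_big => [i|i /negPf nSi]; first by rewrite inE.
  by rewrite mxE nSi.
by rewrite mxE Si.
Qed.

Lemma principal_minor_map (R R' : comPzRingType) (f : {rmorphism R -> R'})
    (n : nat) (A : 'M[R]_n) (S : {set 'I_n}) :
  principal_minor (map_mx f A) S = f (principal_minor A S).
Proof. by rewrite /principal_minor /principal_submx -map_mxsub det_map_mx. Qed.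

(** Over the polynomial ring, [det_scalarD] with [a = 'X] expands the characteristic polynomial of
    [- A]. *)
Lemma Cayley_Hamilton_minors (R : comNzRingType) (n : nat) (A : 'M[R]_n.+1) :
  \sum_(S : {set 'I_n.+1}) principal_minor A S *: (- A) ^+ #|~: S| = 0.
Proof.
rewrite -[RHS](Cayley_Hamilton (- A)) /char_poly /char_poly_mx.
rewrite map_mxN opprK det_scalarD rmorph_sum /=; apply: eq_bigr => S _.
rewrite principal_minor_map rmorphM rmorphXn /= horner_mx_X horner_mx_C.
by rewrite -mul_scalar_mx.
Qed.

(** This is the leading coefficient of [\det (t%:M + A)] as a polynomial in [t]. *)
Lemma principal_minor0 (R : comPzRingType) (n : nat) (A : 'M[R]_n) :
  principal_minor A set0 = 1.
Proof.
by rewrite /principal_minor; move: (principal_submx _ _); rewrite cards0 => M;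
   rewrite det_mx00.
Qed.

(** * Sums of squares *)

(** [C] restricts the elements being squared: no restriction for scalars, the bicommutant of [A] for
    matrices. *)
Inductive sos (R : pzRingType) (C : R -> Prop) : R -> Prop :=
  | sos0 : sos C 0
  | sosS x a of C x & sos C a : sos C (x ^+ 2 + a).

Lemma sos_sqr (R : pzRingType) (C : R -> Prop) (x : R) : C x -> sos C (x ^+ 2).
Proof.
by move=> Cx; rewrite -[x ^+ 2]addr0; apply: sosS => //; apply: sos0.
Qed.

Lemma sosD (R : pzRingType) (C : R -> Prop) (a b : R) :
  sos C a -> sos C b -> sos C (a + b).
Proof.
by move=> + Cb; elim=> [|x a' Cx _ IH]; rewrite ?add0r // -addrA; apply: sosS.
Qed.

Lemma sos_sum (R : pzRingType) (C : R -> Prop) (I : Type) (r : seq I)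
    (P : pred I) (f : I -> R) :
  (forall i, P i -> sos C (f i)) -> sos C (\sum_(i <- r | P i) f i).
Proof. by move=> Cf; apply: big_ind => //; [exact: sos0 | exact: sosD]. Qed.

(** After expansion, commutation turns each [x ^+ 2 * y ^+ 2] into [(x * y) ^+ 2]. *)
Lemma sosM (R : pzRingType) (C : R -> Prop) (a b : R) :
  (forall x y, C x -> C y -> C (x * y)) ->
  (forall x y, C x -> C y -> GRing.comm x y) ->
  sos C a -> sos C b -> sos C (a * b).
Proof.
move=> CM Ccomm + Cb; elim=> [|x a' Cx _ IH].
  by rewrite mul0r; apply: sos0.
rewrite mulrDl; apply: sosD => //.
elim: Cb => [|y b' Cy _ IHb]; first by rewrite mulr0; apply: sos0.
rewrite mulrDr -exprMn_comm; last exact: Ccomm.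
by apply: sosS => //; apply: CM.
Qed.

Lemma sosP (R : pzRingType) (C : R -> Prop) (a : R) :
  sos C a <->
  exists (k : nat) (x : 'I_k -> R),
    (forall i, C (x i)) /\ a = \sum_(i < k) x i ^+ 2.
Proof.
split=> [|[k [x [Cx ->]]]]; last by apply: sos_sum => i _; apply: sos_sqr.
elim=> [|y b Cy _ [k [x [Cx ->]]]].
  by exists 0%N, (fun=> 0); rewrite big_ord0; split=> // -[].
exists k.+1, (fun i => if unlift ord0 i is Some j then x j else y).
split=> [i|]; first by case: unliftP.
rewrite big_ord_recl unlift_none; congr (_ + _).
by apply: eq_bigr => i _; rewrite liftK.
Qed.

Lemma sum_of_squaresP (R : pzRingType) (a : R) :
  sum_of_squares a <-> sos (fun=> True) a.
Proof.
split=> [[k [x ->]]|/sosP[k [x [_ ->]]]]; last by exists k, x.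
by apply/sosP; exists k, x.
Qed.

(** * Sums of squares and symmetric matrices over a real field *)

Section RealField.
Variables (F : fieldType) (hF : real_field F).

(** Otherwise dividing [b = - x ^+ 2] by [x ^+ 2] writes [-1] as a sum of squares. *)
Lemma real_sqrD_eq0 (x b : F) : sos (fun=> True) b -> x ^+ 2 + b = 0 -> x = 0.
Proof.
move=> sb /eqP; rewrite addrC addr_eq0 => /eqP eb; apply/eqP/negP => /negP x0.
apply: hF; apply/sum_of_squaresP.
have -> : -1 = (x^-1) ^+ 2 * b.
  by rewrite eb mulrN exprVn mulVf ?expf_eq0.
by apply: sosM => //; [move=> *; apply: mulrC | apply: sos_sqr].
Qed.

Lemma real_sosD_eq0 (a b : F) :
  sos (fun=> True) a -> sos (fun=> True) b -> a + b = 0 -> a = 0.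
Proof.
elim=> // x a' _ sa IH sb; rewrite -addrA => sum0.
have x0 := real_sqrD_eq0 (sosD sa sb) sum0.
by move: sum0; rewrite x0 expr0n /= !add0r; apply: IH.
Qed.

Lemma sqnormE (n : nat) (v : 'rV[F]_n) : (v *m v^T) 0 0 = \sum_i v 0 i ^+ 2.
Proof. by rewrite mxE; apply: eq_bigr => i _; rewrite mxE. Qed.

Lemma sqnorm_sos (n : nat) (v : 'rV[F]_n) : sos (fun=> True) ((v *m v^T) 0 0).
Proof. by rewrite sqnormE; apply: sos_sum => i _; apply: sos_sqr. Qed.

Lemma real_sqnorm_eq0 (n : nat) (v : 'rV[F]_n) : (v *m v^T) 0 0 = 0 -> v = 0.
Proof.
rewrite sqnormE => norm0; apply/rowP => i; rewrite mxE.
move: norm0; rewrite (bigD1 i) //=; apply: real_sqrD_eq0.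
by apply: sos_sum => j _; apply: sos_sqr.
Qed.

(** By symmetry of [A], the squared norm of [v A] is [v A A v^T]. *)
Lemma real_sym_ker_sqr (n : nat) (A : 'M[F]_n) (v : 'rV_n) :
  A^T = A -> v *m A *m A = 0 -> v *m A = 0.
Proof.
move=> symA vAA; apply: real_sqnorm_eq0.
by rewrite trmx_mul symA mulmxA vAA mul0mx mxE.
Qed.

Lemma real_sym_ker_exp (n : nat) (A : 'M[F]_n.+1) (v : 'rV_n.+1) (k : nat) :
  A^T = A -> v *m A ^+ k = 0 -> v *m A = 0.
Proof.
move=> symA; elim: k => [|k IH].
  by rewrite expr0 mulmx1 => ->; rewrite mul0mx.
case: k IH => [//|k] IH; rewrite !exprSr !mulmxA => vA0; apply: IH.
by rewrite exprSr mulmxA; apply: real_sym_ker_sqr.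
Qed.

(** Stands in for the polynomials in [A]: members commute with one another, and inverses and the
    kernel projection are seen to belong without exhibiting a polynomial. *)
Definition sym_in_bicommutant (n : nat) (A X : 'M[F]_n) : Prop :=
  X^T = X /\ forall N : 'M_n, GRing.comm N A -> GRing.comm N X.

(** * The bicommutant of [A] and the projection onto its kernel *)

Section Bicommutant.
Variables (n : nat) (A : 'M[F]_n.+1).
Hypothesis symA : A^T = A.
Local Notation C := (sym_in_bicommutant A).

Lemma bicommutant_comm X Y : C X -> C Y -> GRing.comm X Y.
Proof. by move=> [_ cX] [_ cY]; apply: cY; apply/commr_sym/cX. Qed.

Lemma bicommutantM X Y : C X -> C Y -> C (X * Y).
Proof.
move=> CX CY; split=> [|N NA].
  by rewrite trmx_mul CX.1 CY.1 -[RHS](bicommutant_comm CY CX).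
by apply: commrM; [apply: CX.2 | apply: CY.2].
Qed.

Lemma bicommutantX k : C (A ^+ k).
Proof.
elim: k => [|k IH]; last by rewrite exprS; apply: bicommutantM.
by split=> [|N _]; [rewrite expr0 trmx1 | apply: commr1].
Qed.

Lemma bicommutantZ c X : C X -> C (c *: X).
Proof.
move=> CX; split=> [|N NA]; first by rewrite linearZ /= CX.1.
by rewrite /GRing.comm -scalerAl -scalerAr CX.2.
Qed.

Lemma bicommutantD X Y : C X -> C Y -> C (X + Y).
Proof.
move=> CX CY; split=> [|N NA]; first by rewrite linearD /= CX.1 CY.1.
by apply: commrD; [apply: CX.2 | apply: CY.2].
Qed.

Lemma bicommutant_sos X : sos C X -> C X.
Proof.
elim=> [|Y Z CY _ CZ]; last by apply: bicommutantD => //; apply: bicommutantM.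
by split=> [|N _]; [rewrite trmx0 | apply: commr0].
Qed.

Lemma bicommutantV X : C X -> C X^-1.
Proof.
move=> CX; split=> [|N NA]; first by rewrite trmx_inv CX.1.
exact/commrV/CX.2.
Qed.

(** If [c] is the sum of the [x_i ^+ 2], then [c X^2] is the sum of the [(x_i X)^2]. *)
Lemma bicommutant_sosZ c X : sos (fun=> True) c -> C X -> sos C (c *: X ^+ 2).
Proof.
move=> + CX; elim=> [|x b _ _ IH]; first by rewrite scale0r; apply: sos0.
by rewrite scalerDl -exprZn; apply: sosS => //; apply: bicommutantZ.
Qed.

(* [P] is the orthogonal projection onto [ker A]. *)
Lemma real_sym_ker_proj : exists P : 'M[F]_n.+1,
  [/\ C P, A * P = 0, P * P = P &
      forall v : 'rV_n.+1, v *m A = 0 -> v *m P = v].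
Proof.
(* [A] and [A *m A] have the same row space: by [real_sym_ker_sqr], whatever [A *m A] kills is
   killed by [A]. *)
have /submxP[X defA] : (A <= A *m A)%MS.
  rewrite submxE; apply/eqP; set K := cokermx _.
  have AAK : A *m A *m K = 0 by apply: mulmx_coker.
  have symAA : (A *m A)^T = A *m A by rewrite trmx_mul symA.
  have KAA : K^T *m (A *m A) = 0 by rewrite -symAA -trmx_mul AAK trmx0.
  apply: trmx_inj; rewrite trmx0 trmx_mul symA; apply/row_matrixP => i.
  by rewrite row0 row_mul real_sym_ker_sqr // -!row_mul -mulmxA KAA row0.
pose P := 1 - X * A.
have PA : P * A = 0.
  by rewrite mulrBl mul1r -mulrA [X * _](esym defA) subrr.
have tXA : (X * A)^T = A * X^T by rewrite trmx_mul symA.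
have tP : P^T = 1 - A * X^T by rewrite linearB /= trmx1 tXA.
(* Since [P * A = 0], [P] equals [P * P^T], which is symmetric. *)
have symP : P^T = P.
  have PtP : P * P^T = P by rewrite tP mulrBr mulr1 mulrA PA mul0r subr0.
  by rewrite -PtP trmx_mul trmxK.
have AP : A * P = 0.
  by apply: trmx_inj; rewrite trmx_mul symP symA trmx0; exact: PA.
have XAP : 1 - P = X * A by rewrite opprB addrC subrK.
have AtXP : 1 - P = A * X^T by rewrite -symP tP opprB addrC subrK.
exists P; split=> //.
(* As [1 - P] is both [A X^T] and [X A], the products [P N (1 - P)] and [(1 - P) N P] vanish, so
   [P N] and [N P] both equal [P N P]. *)
- split=> // N NA.
  have PN : P * N = P * N * P.
    apply/eqP; rewrite -subr_eq0 -{1}[P * N]mulr1 -mulrBr AtXP mulrA -(mulrA P).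
    by rewrite NA mulrA PA !mul0r.
  have NP : N * P = P * N * P.
    apply/eqP; rewrite -subr_eq0 -{1}[N]mul1r -mulrBl -mulrBl XAP -(mulrA X).
    by rewrite -NA -!mulrA AP !mulr0.
  by rewrite /GRing.comm NP -PN.
- by rewrite -{2}symP tP mulrBr mulr1 mulrA PA mul0r subr0.
- move=> v vA; rewrite -symP tP mulmxBr mulmx1 [A * _]/(A *m _) mulmxA vA.
  by rewrite mul0mx subr0.
Qed.

End Bicommutant.
End RealField.

(* Cayley-Hamilton for [- A], with the terms separated by parity and multiplied
   by [A] when the dimension is even, so that only even powers remain. *)
Lemma Cayley_Hamilton_parity (R : comNzRingType) (n : nat) (A : 'M[R]_n.+1) :
  A * (\sum_(S : {set 'I_n.+1} | odd #|~: S| == odd n.+1)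
         principal_minor A S *: (A ^+ #|~: S|./2) ^+ 2) =
  \sum_(S : {set 'I_n.+1} | odd #|~: S| != odd n.+1)
    principal_minor A S *: (A ^+ uphalf #|~: S|) ^+ 2.
Proof.
move: (odd n.+1) => e.
have neq_negb (a b : bool) : a != b -> a = ~~ b by case: a b => [] [].
have eqGH :
    \sum_(S : {set 'I_n.+1} | odd #|~: S| == e)
      principal_minor A S *: A ^+ #|~: S| =
    \sum_(S : {set 'I_n.+1} | odd #|~: S| != e)
      principal_minor A S *: A ^+ #|~: S|.
  have sgn (S : {set 'I_n.+1}) : principal_minor A S *: (- A) ^+ #|~: S| =
      (-1) ^+ odd #|~: S| *: (principal_minor A S *: A ^+ #|~: S|).
    rewrite scaler_sign (exprNn A) -signr_odd mulr_sign.
    by case: ifP; rewrite ?scalerN.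
  have := Cayley_Hamilton_minors A.
  rewrite (bigID (fun S => odd #|~: S| == e)) /=.
  under eq_bigr => S /eqP eS do rewrite sgn eS.
  under [X in _ + X]eq_bigr => S neS do rewrite sgn (neq_negb _ _ neS).
  rewrite -!scaler_sumr; case: e => /=.
    rewrite expr0 expr1 scale1r scaleN1r addrC => /eqP.
    by rewrite subr_eq0 => /eqP.
  by rewrite expr0 expr1 scale1r scaleN1r => /eqP; rewrite subr_eq0 => /eqP.
(* The exponent [~~ e] is 1 exactly in even dimension. With [k = #|~: S|], [~~ e + k] is
   [1 + 2 * k./2] when [k] has parity [e], and [2 * uphalf k] otherwise. *)
transitivity (A ^+ (~~ e) * \sum_(S : {set 'I_n.+1} | odd #|~: S| == e)
                            principal_minor A S *: A ^+ #|~: S|); last first.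
  rewrite eqGH mulr_sumr; apply: eq_bigr => S neS.
  rewrite -scalerAr -exprD -exprM muln2 uphalfK.
  by rewrite (neq_negb _ _ neS).
rewrite !mulr_sumr; apply: eq_bigr => S /eqP eS.
rewrite -!scalerAr -exprM muln2 -exprS -exprD.
rewrite -[in RHS](odd_double_half #|~: S|).
by rewrite eS addnA; case: (e).
Qed.

Theorem theorem3 (F : fieldType) (hF : real_field F) (n : nat) (hn : (0 < n)%N)
    (A : 'M[F]_n) (symA : A \is symmetricmx)
    (minorA : forall S : {set 'I_n}, S != set0 ->
       sum_of_squares (principal_minor A S)) :
  exists (k : nat) (B : 'I_k -> 'M[F]_n),
    (forall i : 'I_k, B i \is symmetricmx) /\ A = \sum_(i < k) B i ^+ 2.
Proof.
case: n hn A symA minorA => // n _ A /is_hermitianmxP symA minorA.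
(* [symmetricmx] is the hermitian predicate with trivial sign and identity conjugation. *)
rewrite expr0 scale1r map_mx_id // in symA.
have {}symA : A^T = A by [].
have minor_sos (S : {set 'I_n.+1}) : sos (fun=> True) (principal_minor A S).
  have [->|S0] := eqVneq S set0; last exact/sum_of_squaresP/minorA.
  by rewrite principal_minor0 -(expr1n _ 2); apply: sos_sqr.
pose C := sym_in_bicommutant A.
have sosC (p : pred {set 'I_n.+1}) (f : nat -> nat) :
    sos C (\sum_(S | p S) principal_minor A S *: (A ^+ f #|~: S|) ^+ 2).
  by apply: sos_sum => S _; apply: bicommutant_sosZ => //; apply: bicommutantX.
have [P [CP AP PP kerP]] := real_sym_ker_proj hF symA.
have := Cayley_Hamilton_parity A.
move: (sosC (fun S => odd #|~: S| == odd n.+1) half).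
set U := \sum_(S | _) _ => sosU.
move: (sosC (fun S => odd #|~: S| != odd n.+1) uphalf).
set T := \sum_(S | _) _ => sosT AU.
have sosQ : sos C (U + P).
  by rewrite -PP -expr2; apply: sosD => //; apply: sos_sqr.
have CQ : C (U + P) by apply: bicommutant_sos.
have AQ : A * (U + P) = T by rewrite mulrDr AP addr0.
have sqr_form (v : 'rV_n.+1) X : C X ->
    (v *m X ^+ 2 *m v^T) 0 0 = ((v *m X) *m (v *m X)^T) 0 0.
  by move=> CX; rewrite expr2 trmx_mul CX.1 !mulmxA.
(* If [v] is in the kernel, the forms of [U] and [P] at [v] are sums of squares with sum 0, so each
   vanishes. *)
have unitQ : U + P \in unitmx.
  rewrite -row_free_unit; apply: inj_row_free => v vQ.
  have form0 : (v *m (U + P) *m v^T) 0 0 = 0 by rewrite vQ mul0mx mxE.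
  have sos_form X : sos C X -> sos (fun=> True) ((v *m X *m v^T) 0 0).
    elim=> [|Y Z CY _ IH]; first by rewrite mulmx0 mul0mx mxE; apply: sos0.
    rewrite mulmxDr mulmxDl mxE; apply: sosD => //.
    by rewrite sqr_form //; apply: sqnorm_sos.
  have vA : v *m A = 0.
    (* The term [S = set0] of [U] is [(A ^+ m) ^+ 2], so the squared norm of [v A^m] vanishes. In
       dimension 1, [m] is 0. *)
    pose m := n.+1./2; apply: (@real_sym_ker_exp _ hF _ _ _ m) => //.
    apply: real_sqnorm_eq0 => //.
    rewrite -sqr_form; last exact: bicommutantX.
    move: form0; rewrite /U (bigD1 set0) /= ?setC0 ?cardsT ?card_ord //.
    rewrite principal_minor0 scale1r -addrA mulmxDr mulmxDl mxE.
    apply: real_sosD_eq0 => //; apply: sos_form.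
      by apply: sos_sqr; apply: bicommutantX.
    apply: sosD; first exact: sosC.
    by rewrite -PP -expr2; apply: sos_sqr.
  (* Now [v = v P], and its squared norm is the form of [P] at [v]. *)
  rewrite -(kerP v vA); apply: real_sqnorm_eq0 => //; rewrite -sqr_form //.
  move: form0; rewrite expr2 PP addrC mulmxDr mulmxDl mxE.
  apply: real_sosD_eq0 => //; apply: sos_form => //.
  by rewrite -PP; apply: sos_sqr.
(* Writing the inverse of [U + P] as [U + P] times the square of its inverse makes every factor a
   sum of squares. *)
have defA : A = T * (U + P) * (U + P)^-1 ^+ 2.
  by rewrite -AQ expr2 mulrA !mulrK.
have /sosP[k [B [CB sumB]]] : sos C A.
  rewrite defA; apply: sosM; [exact: bicommutantM|exact: bicommutant_comm| |].
    by apply: sosM => //; [exact: bicommutantM|exact: bicommutant_comm].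
  by apply: sos_sqr; apply: bicommutantV.
exists k, B; split=> // i; apply/is_hermitianmxP.
by rewrite expr0 scale1r map_mx_id // (CB i).1.
Qed.
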